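(* Consider the TOTEM constructed by an irreducible vector operator $\mathbf M$ over the admissible configurations $\mathcal D_\star$, and the $I$-projection $\mathfrak q$ of the reference distribution $\upsilon$ onto the TOTEMplex $[\mathfrak f;\mathbf M]$. At large $N$, the probability fluctuations $\boldsymbol\pi=\mathfrak p-\mathfrak q\in\ker\mathbf M$ around the $I$-projection of $\upsilon$ are controlled by Gaussian approximation, in the sense of predominantly following a $|\ker\mathbf M|$-dimensional normal distribution of zero mean and $\mathcal O(1/N)$ variance.
   Context: $\mathcal D$ is a finite set of configurations (entities) and $\mathcal D_\star\subseteq\mathcal D$ is the subset of admissible ones; the others are declared null. $\mathcal P(\mathcal D_\star)$ is the simplex of $\mathfrak p=(p_e)_{e\in\mathcal D_\star}$ with $p_e\ge0$ and $\sum_e p_e=1$. $N$ is the sample size of a dataset. Its empirical distribution $\mathfrak f$ consists of the relative frequencies $f_e$, $e\in\mathcal D$, with $f_e=0$ for $e\notin\mathcal D_\star$. The reference $\upsilon$ is a probability distribution on $\mathcal D$ with $\upsilon_e>0$ for $e\in\mathcal D_\star$; it expresses prior knowledge. An irreducible vector operator $\mathbf M$ over $\mathcal D_\star$ is a collection of $D$ linearly independent real functions $m_1,\dots,m_D$ on $\mathcal D_\star$ (the eigenvalues of diagonal operators); normalization (the constant function $1$) is always taken to be implied by $\mathbf M$, i.e. to lie in the span. $\ker\mathbf M=\{\boldsymbol\pi\in\mathbb R^{\mathcal D_\star}:\sum_e m_\alpha(e)\pi_e=0,\ \alpha=1,\dots,D\}$, and $|\ker\mathbf M|=|\mathcal D_\star|-D$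 denotes its dimension. The TOTEM constructed by $\mathbf M$ is the selection of those distributions that reproduce the empirical expectations of $\mathbf M$; they form the TOTEMplex $[\mathfrak f;\mathbf M]=\{\mathfrak p\in\mathcal P(\mathcal D_\star):\sum_e m_\alpha(e)p_e=\sum_e m_\alpha(e)f_e,\ \alpha=1,\dots,D\}$. The $I$-divergence is $D(\mathfrak p\|\mathfrak r)=\sum_e p_e\log(p_e/r_e)$ with $0\log0=0$. The $I$-projection $\mathfrak q$ of $\upsilon$ onto $[\mathfrak f;\mathbf M]$ is the unique minimizer of $D(\mathfrak p\|\upsilon)$ over $\mathfrak p\in[\mathfrak f;\mathbf M]$. The fluctuations are distributed as follows. Distributions on the TOTEMplex are sampled from $\upsilon$ according to the multinomial law of the counts $N\mathfrak p$, extended to a probability density on $[\mathfrak f;\mathbf M]$ in a large-$N$ expansion. To leading order in $N$ this density is $f(\mathfrak p)=Z^{-1}\exp\{-N\,D(\mathfrak p\|\upsilon)\}$, equivalently (with redefined $Z$) $Z^{-1}\exp\{-N\,D(\mathfrak p\|\mathfrak q)\}$, where $Z$ normalizes over $[\mathfrak f;\mathbf M]$. A fluctuation $\boldsymbol\pi$ is admissible when $\mathfrak q+\boldsymbol\pi$ has non-negative entries.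
   Formalization: The normalization Z over the TOTEMplex is assumed positive, i.e. the TOTEMplex has full dimension |ker M|; otherwise (e.g. when it is a single point and ker M is nonzero) no |ker M|-dimensional normal law can arise. *)

(* Defs.v *)
From HB Require Import structures.
From mathcomp Require Import all_boot all_order all_algebra.
From mathcomp Require Import all_classical all_reals all_analysis.

Set Implicit Arguments.
Unset Strict Implicit.
Unset Printing Implicit Defensive.

Import Order.TTheory GRing.Theory Num.Theory.
Import numFieldNormedType.Exports.

Local Open Scope classical_set_scope.
Local Open Scope ring_scope.

Section lebesgue_tuple.
Context {R : realType}.

Local Notation tupleR n := (n.-tuple (measurableTypeR R)).

Section cons.
Context {n : nat}.

Definition tcons (p : measurableTypeR R * tupleR n) : tupleR n.+1 :=
  [tuple of p.1 :: p.2].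

Lemma measurable_tcons : measurable_fun [set: measurableTypeR R * tupleR n] tcons.
Proof. exact: (measurable_cons measurable_fst measurable_snd). Qed.

Definition tuncons (t : tupleR n.+1) : measurableTypeR R * tupleR n :=
  (thead t, [tuple of behead t]).

Lemma tconsK : cancel tcons tuncons.
Proof.
by case=> x t; rewrite /tuncons /tcons /= theadE; congr pair; exact: val_inj.
Qed.

Lemma measurable_tuncons : measurable_fun [set: tupleR n.+1] tuncons.
Proof.
apply/measurable_fun_pairP; split; first exact: measurable_tnth.
exact: measurable_behead.
Qed.

Variable mu : {sigma_finite_measure set (tupleR n) -> \bar R}.

Definition lebesgue_cons : set (tupleR n.+1) -> \bar R :=
  pushforward (@lebesgue_measure R \x mu)%E tcons.

Let lebesgue_cons0 : lebesgue_cons set0 = 0%E.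
Proof. by rewrite /lebesgue_cons /pushforward preimage_set0 measure0. Qed.

Let lebesgue_cons_ge0 A : (0 <= lebesgue_cons A)%E.
Proof. by rewrite /lebesgue_cons /pushforward measure_ge0. Qed.

Let lebesgue_cons_sigma_additive : semi_sigma_additive lebesgue_cons.
Proof.
move=> F mF tF mUF; rewrite /lebesgue_cons /pushforward preimage_bigcup.
apply: measure_semi_sigma_additive.
- by move=> k; rewrite -[X in measurable X]setTI; exact: measurable_tcons.
- apply/trivIsetP => /= i j _ _ ij; rewrite -preimage_setI.
  by move/trivIsetP : tF => -> //; rewrite preimage_set0.
- by rewrite -preimage_bigcup -[X in measurable X]setTI; exact: measurable_tcons.
Qed.

HB.instance Definition _ := isMeasure.Build _ _ _ lebesgue_cons
  lebesgue_cons0 lebesgue_cons_ge0 lebesgue_cons_sigma_additive.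

Let lebesgue_cons_sigma_finite : sigma_finite setT lebesgue_cons.
Proof.
have /sigma_finiteP[F [TF ndF Foo]] := sigma_finiteT (@lebesgue_measure R).
have /sigma_finiteP[G [TG ndG Goo]] := sigma_finiteT mu.
exists (fun k => tuncons @^-1` (F k `*` G k)).
  rewrite -preimage_bigcup; apply/esym; rewrite -subTset => t _.
  have [i _ Fi] : (\bigcup_i F i) (tuncons t).1 by rewrite -TF.
  have [j _ Gj] : (\bigcup_i G i) (tuncons t).2 by rewrite -TG.
  exists (maxn i j) => //; split.
  - by move: Fi; exact/subsetPset/ndF/leq_maxl.
  - by move: Gj; exact/subsetPset/ndG/leq_maxr.
move=> k; have [mF muF] := Foo k; have [mG muG] := Goo k; split.
  by rewrite -[X in measurable X]setTI; apply: measurable_tuncons => //;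
     exact: measurableX.
rewrite /lebesgue_cons /pushforward -comp_preimage.
rewrite (_ : tuncons \o tcons = id); last by apply/funext => p; exact: tconsK.
by rewrite preimage_id product_measure1E// lte_mul_pinfty// ge0_fin_numE.
Qed.

HB.instance Definition _ := Measure_isSigmaFinite.Build _ _ _ lebesgue_cons
  lebesgue_cons_sigma_finite.

End cons.

Fixpoint lebesgue_tuple (n : nat) :
    {sigma_finite_measure set (tupleR n) -> \bar R} :=
  match n with
  | 0 => \d_([tuple] : tupleR 0)
  | n'.+1 => lebesgue_cons (lebesgue_tuple n')
  end.

End lebesgue_tuple.

Section multivariate_normal.
Context {R : realType}.

Definition row_of_tuple {n} (x : n.-tuple (measurableTypeR R)) : 'rV[R]_n :=
  \row_i tnth x i.

Definition posdefmx {n} (S : 'M[R]_n) : Prop :=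
  S^T = S /\ forall v : 'rV[R]_n, v != 0 -> 0 < (v *m S *m v^T) 0 0.

Definition mvnormal_pdf {n} (m : 'rV[R]_n) (S : 'M[R]_n) (x : 'rV[R]_n) : R :=
  (Num.sqrt ((pi *+ 2) ^+ n * \det S))^-1 *
  expR (- ((x - m) *m invmx S *m (x - m)^T) 0 0 / 2).

Definition mvnormal_prob {n} (m : 'rV[R]_n) (S : 'M[R]_n)
    (A : set (n.-tuple (measurableTypeR R))) : \bar R :=
  (\int[lebesgue_tuple n]_(x in A) (mvnormal_pdf m S (row_of_tuple x))%:E)%E.

End multivariate_normal.

Definition tv_dist d (T : measurableType d) (R : realType)
    (P Q : set T -> \bar R) : \bar R :=
  ereal_sup [set `|P A - Q A|%E | A in measurable].

Section totem.
Context {R : realType} {T : finType}.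
Definition is_distribution (p : T -> R) : Prop :=
  (forall e, 0 <= p e) /\ \sum_e p e = 1.

(* Functions on the admissible set Ds are row vectors indexed by 'I_#|Ds|,
   entry j being the value at [enum_val j]. *)
Definition restr (Ds : {set T}) (p : T -> R) : 'rV[R]_#|Ds| := \row_j p (enum_val j).

End totem.

Section totemplex.
Context {R : realType} {n : nat}.
Implicit Types (p q r f : 'rV[R]_n) (N : nat).

Definition simplex : set 'rV[R]_n :=
  [set p | (forall j, 0 <= p 0 j) /\ \sum_j p 0 j = 1].

(* Row alpha of M lists the values of m_alpha. *)
Definition irreducible_operator {D} (M : 'M[R]_(D, n)) : Prop :=
  row_free M /\ ((const_mx 1 : 'rV[R]_n) <= M)%MS.

(* The row space of [opker M] is {pi | sum_e m_alpha(e) pi_e = 0}. *)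
Definition opker {D} (M : 'M[R]_(D, n)) : 'M[R]_n := kermx M^T.

Definition dim_opker {D} (M : 'M[R]_(D, n)) : nat := \rank (opker M).

Lemma dim_opkerE {D} (M : 'M[R]_(D, n)) :
  irreducible_operator M -> dim_opker M = (n - D)%N.
Proof. by case=> /eqP rM _; rewrite /dim_opker mxrank_ker mxrank_tr rM. Qed.

Definition totemplex {D} f (M : 'M[R]_(D, n)) : set 'rV[R]_n :=
  [set p | simplex p /\ p *m M^T = f *m M^T].

(* As [ln 0 = 0], this follows the convention 0 log 0 = 0. *)
Definition Idiv p r : R := \sum_j p 0 j * ln (p 0 j / r 0 j).

Definition is_Iprojection r (C : set 'rV[R]_n) q : Prop :=
  C q /\ forall p, C p -> Idiv q r <= Idiv p r.

Section fluctuations.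
Context {D : nat}.
Variables (r f : 'rV[R]_n) (M : 'M[R]_(D, n)) (q : 'rV[R]_n).
Variable B : 'M[R]_(dim_opker M, n).

Local Notation coords := ((dim_opker M).-tuple (measurableTypeR R)).

(* The fluctuation with coordinates x in the basis of the kernel given by the
   rows of B *)
Definition fluct (x : coords) : 'rV[R]_n := row_of_tuple x *m B.

Definition fluct_dom : set coords := [set x | totemplex f M (q + fluct x)].

Definition fluct_weight N (x : coords) : R :=
  expR (- (N%:R * Idiv (q + fluct x) r)).

Definition fluct_Z N : \bar R :=
  (\int[lebesgue_tuple _]_(x in fluct_dom) (fluct_weight N x)%:E)%E.

(* The law, in coordinates, of the fluctuation p - q when p has density
   exp(- N Idiv p r) / Z on the TOTEMplex; changing the basis B only changes
   Lebesgue measure by a constant factor, which Z absorbs. *)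
Definition fluct_prob N (A : set coords) : \bar R :=
  ((fine (fluct_Z N))^-1%:E *
   \int[lebesgue_tuple _]_(x in A `&` fluct_dom) (fluct_weight N x)%:E)%E.

End fluctuations.
End totemplex.

(* Main.v *)
Require Import Defs.
From HB Require Import structures.
From mathcomp Require Import all_boot all_order all_algebra.
From mathcomp Require Import all_classical all_reals all_analysis.
From mathcomp Require Import measurable_realfun ring lra.

Set Implicit Arguments.
Unset Strict Implicit.
Unset Printing Implicit Defensive.

Import Order.TTheory GRing.Theory Num.Theory.
Import numFieldNormedType.Exports.

Local Open Scope classical_set_scope.
Local Open Scope ring_scope.

(** This is Laplace's method around the minimum of the I-divergence, carried out
    with explicit inequalities.

    Write h(t) = (1 + t) ln (1 + t) - t. The I-divergence of q + pi >= 0 splits as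
      D(q + pi || r) = D(q || r) + \sum_j pi_j ln (q_j / r_j)
                       + \sum_j q_j h(pi_j / q_j)
    when \sum_j pi_j = 0 and pi vanishes where q does ([Idiv_expand]). Two facts on
    the I-projection q make this usable on the whole TOTEMplex. A coordinate of q
    can vanish only if every element of ker M vanishes there
    ([Iprojection_null_coord]): otherwise, the TOTEMplex having positive volume,
    some p in it is positive at that coordinate, and the infinite slope of
    t ln t at 0 makes a small step from q towards p decrease the divergence. Hence
    q can be moved both ways along ker M, and minimality kills the linear term
    ([Iprojection_first_order]). What remains, the excess g(x) in coordinates x,
    satisfies, with Q(x) = x P x^T / 2 the second-order term
    \sum_j pi_j^2 / (2 q_j):
    - near the origin, Q / (1 + d) <= g <= Q / (1 - d) for every small d
      ([excess_local]);
    - everywhere on the TOTEMplex, g >= c Q for some c > 0 ([excess_ge]).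

    So exp(- N g) and exp(- N Q) are both squeezed between exp(- N Q / (1 - d)) and
    exp(- N Q / (1 + d)) near the origin, and are exponentially small compared with
    exp(- N c Q / 2) elsewhere ([expR_sandwich]). All these bounds are Gaussian, and
    the integral of exp(- a Q) is an exact multiple of a ^ (- k / 2)
    ([integral_expR_quad]), so that the L1 distance of exp(- N g) and exp(- N Q)
    relative to the mass of the latter has a limit superior of at most
    (1 + d) ^ (k / 2) - (1 - d) ^ (k / 2) ([laplace_tv]). Letting d tend to 0, the law
    of the fluctuations approaches in total variation the centred normal law of
    covariance (N P)^-1.

    The Gaussian integral in k variables is computed one variable at a time:
    completing the square in the first variable leaves the form of the Schur
    complement, whose determinant is that of the matrix divided by the leading
    entry. *)

(** * Positive definite quadratic forms *)

Section quadratic_form.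
Context {R : realType}.

Definition quad n (L : 'M[R]_n) (x : 'rV[R]_n) : R := (x *m L *m x^T) 0 0.

(** The Schur complement of the leading entry: the form that remains when the
    first variable is eliminated by completing the square. *)
Definition schur n (L : 'M[R]_(1 + n)) : 'M[R]_n :=
  drsubmx L - (L 0 0)^-1 *: ((ursubmx L)^T *m ursubmx L).

(** One step of the L D L^T factorization; the quadratic form, its definiteness and
    its determinant are all read off from it. *)
Lemma schur_factor n (L : 'M[R]_(1 + n)) : L^T = L -> L 0 0 != 0 ->
  let U : 'M[R]_(1 + n) := block_mx 1%:M ((L 0 0)^-1 *: ursubmx L) 0 1%:M in
  L = U^T *m block_mx (L 0 0)%:M 0 0 (schur L) *m U.
Proof.
move=> symL a0 /=; set a := L 0 0 in a0 *.
rewrite tr_block_mx !mulmx_block !trmx0 !trmx1.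
rewrite !(mul1mx, mulmx1, mul0mx, mulmx0, addr0, add0r).
rewrite -scalemxAr mul_scalar_mx scalerA mulVf// scale1r.
rewrite linearZ/= -scalemxAl mul_mx_scalar scalerA mulVf// scale1r.
rewrite -scalemxAr addrC subrK -{1}[L]submxK; congr block_mx.
  by rewrite [LHS]mx11_scalar !mxE !lshift0.
by rewrite trmx_ursub symL.
Qed.

Lemma quad_schur n (L : 'M[R]_(1 + n)) (x : R) (y : 'rV[R]_n) :
  L^T = L -> L 0 0 != 0 ->
  quad L (row_mx x%:M y) =
  L 0 0 * (x + (y *m (ursubmx L)^T) 0 0 / L 0 0) ^+ 2 + quad (schur L) y.
Proof.
move=> symL a0; rewrite /quad {1}(schur_factor symL a0).
set a := L 0 0 in a0 *; set b := ursubmx L; set c := (y *m b^T) 0 0.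
set U := block_mx _ _ _ _; set z := row_mx _ _.
have -> : z *m (U^T *m block_mx a%:M 0 0 (schur L) *m U) *m z^T =
    (z *m U^T) *m block_mx a%:M 0 0 (schur L) *m (z *m U^T)^T.
  by rewrite trmx_mul trmxK !mulmxA.
have -> : z *m U^T = row_mx (x + c / a)%:M y.
  rewrite tr_block_mx mul_row_block !trmx1 trmx0 !mulmx1 mulmx0 add0r.
  congr row_mx; rewrite linearZ/= -scalemxAr (mx11_scalar (y *m b^T)) -/c.
  by rewrite scale_scalar_mx -raddfD/= mulrC.
rewrite mul_row_block !(mulmx0, addr0, add0r) tr_row_mx mul_row_col.
rewrite tr_scalar_mx -!scalar_mxM !mxE eqxx mulr1n; congr (_ + _).
by rewrite mulrAC mulrC.
Qed.

Lemma det_schur n (L : 'M[R]_(1 + n)) : L^T = L -> L 0 0 != 0 ->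
  \det L = L 0 0 * \det (schur L).
Proof.
move=> symL a0; rewrite {1}(schur_factor symL a0) !det_mulmx det_tr !det_ublock.
by rewrite !det1 !mul1r mulr1 det_scalar1.
Qed.

Lemma posdefmx_diag0 n (L : 'M[R]_(1 + n)) : posdefmx L -> 0 < L 0 0.
Proof.
move=> [_ /(_ (delta_mx 0 0))]; rewrite trmx_delta -rowE -colE !mxE; apply.
by apply/eqP => /matrixP/(_ 0 0)/eqP; rewrite !mxE !eqxx oner_eq0.
Qed.

(** The values of the Schur complement are values of the form itself, taken at the
    first coordinate that minimizes it. *)
Lemma posdefmx_schur n (L : 'M[R]_(1 + n)) : posdefmx L -> posdefmx (schur L).
Proof.
move=> posL; have a_gt0 := posdefmx_diag0 posL; case: posL => symL posL.
split.
  rewrite /schur linearB/= linearZ/= trmx_mul trmxK; congr (_ - _).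
  by rewrite trmx_drsub symL.
move=> v v0; set c := (v *m (ursubmx L)^T) 0 0.
have := quad_schur (- (c / L 0 0)) v symL (lt0r_neq0 a_gt0).
rewrite -/c addNr expr0n/= mulr0 add0r -[X in 0 < X]/(quad (schur L) v) => <-.
apply: posL; apply: contra_neq v0 => /(congr1 rsubmx).
by rewrite row_mxKr linear0.
Qed.

Lemma det_posdefmx_gt0 n (L : 'M[R]_n) : posdefmx L -> 0 < \det L.
Proof.
elim: n L => [|n IH] L posL; first by rewrite det_mx00 ltr01.
have a_gt0 := posdefmx_diag0 (n := n) posL; case: (posL) => symL _.
rewrite (@det_schur n)// ?lt0r_neq0// mulr_gt0//.
exact/IH/posdefmx_schur.
Qed.

Lemma posdefmxZ k (L : 'M[R]_k) (a : R) : 0 < a -> posdefmx L -> posdefmx (a *: L).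
Proof.
move=> a0 [symL posL]; split=> [|v v0]; first by rewrite linearZ/= symL.
by rewrite -scalemxAr -scalemxAl mxE mulr_gt0// posL.
Qed.

Lemma posdefmx_unit k (L : 'M[R]_k) : posdefmx L -> L \in unitmx.
Proof. by move=> /det_posdefmx_gt0 L0; rewrite unitmxE unitfE lt0r_neq0. Qed.

Lemma posdefmx_inv k (L : 'M[R]_k) : posdefmx L -> posdefmx (invmx L).
Proof.
move=> posL; have uL := posdefmx_unit posL; case: posL => symL posL.
split=> [|v v0]; first by rewrite trmx_inv symL.
have -> : v *m invmx L *m v^T = (v *m invmx L) *m L *m (v *m invmx L)^T.
  by rewrite trmx_mul trmx_inv symL mulmxKV// mulmxA.
apply: posL; apply: contra_neq v0 => h.
by rewrite -[v](mulmxKV uL) h mul0mx.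
Qed.

Lemma quadZ k (L : 'M[R]_k) a x : quad (a *: L) x = a * quad L x.
Proof. by rewrite /quad -scalemxAr -scalemxAl mxE. Qed.

Lemma quad_ge0 k (L : 'M[R]_k) x : posdefmx L -> 0 <= quad L x.
Proof.
move=> [_ posL]; have [->|/posL/ltW//] := eqVneq x 0.
by rewrite /quad !mul0mx mxE.
Qed.
End quadratic_form.

(** * Gaussian integrals over tuples *)

Section lebesgue_tuple_integral.
Context {R : realType}.
Local Notation tupleR n := (n.-tuple (measurableTypeR R)).

Lemma integral_gauss (a m : R) : 0 < a ->
  (\int[lebesgue_measure]_x (expR (- (a * (x - m) ^+ 2) / 2))%:E)%E =
  (Num.sqrt (pi *+ 2 / a))%:E.
Proof.
move=> a_gt0; pose s := (Num.sqrt a)^-1.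
have s_neq0 : s != 0 by rewrite invr_eq0 gt_eqF// sqrtr_gt0.
have s2 : s ^+ 2 = a^-1 by rewrite exprVn sqr_sqrtr// ltW.
rewrite -[RHS]mule1 -(integral_normal_pdf m s).
rewrite -ge0_integralZl_EFin//=; last 2 first.
- by move=> x _; rewrite lee_fin normal_pdf_ge0.
- by apply/measurable_EFinP; exact: measurable_normal_pdf.
apply: eq_integral => x _; rewrite -EFinM; congr (_%:E).
rewrite normal_pdfE// /normal_peak /normal_fun s2.
have -> : pi *+ 2 / a = a^-1 * pi *+ 2 by rewrite mulrC mulrnAr.
rewrite [RHS]mulrA divff ?mul1r; last first.
  by rewrite gt_eqF// sqrtr_gt0 mulrn_wgt0// mulr_gt0 ?invr_gt0 ?pi_gt0.
by congr expR; rewrite -mulr_natr; field; rewrite lt0r_neq0.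
Qed.

Lemma row_of_tcons n (x : R) (y : tupleR n) :
  row_of_tuple (tcons (x, y)) = row_mx x%:M (row_of_tuple y) :> 'rV[R]_(1 + n).
Proof.
apply/rowP => i; rewrite !mxE; case: splitP => k ik.
  by rewrite ord1 in ik; rewrite mxE ord1 (_ : i = ord0)//; exact/val_inj.
by rewrite mxE (_ : i = lift ord0 k) ?tnthS//; exact/val_inj.
Qed.

Lemma measurable_mulmx_coord n p (B : 'M[R]_(n, p)) j :
  measurable_fun setT (fun x : tupleR n => (row_of_tuple x *m B) 0 j).
Proof.
under eq_fun do rewrite mxE; apply: measurable_sum => i.
under eq_fun do rewrite mxE.
by apply: measurable_funM => //; exact: measurable_tnth.
Qed.

Lemma measurable_quad n (L : 'M[R]_n) :
  measurable_fun setT (fun x : tupleR n => quad L (row_of_tuple x)).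
Proof.
under eq_fun do rewrite /quad mxE; apply: measurable_sum => i.
apply: measurable_funM; first exact: measurable_mulmx_coord.
by under eq_fun do rewrite !mxE; exact: measurable_tnth.
Qed.

Local Open Scope ereal_scope.

Lemma integral_lebesgue_tupleS n (f : tupleR n.+1 -> \bar R) :
  measurable_fun setT f -> (forall t, 0 <= f t) ->
  \int[lebesgue_tuple n.+1]_t f t =
  \int[lebesgue_tuple n]_y \int[lebesgue_measure]_x f (tcons (x, y)).
Proof.
move=> mf f0; rewrite /= /lebesgue_cons ge0_integral_pushforward//.
- rewrite preimage_setT (fubini_tonelli2 (f \o tcons))//.
    by apply: (measurableT_comp mf); exact: measurable_tcons.
  by move=> t; exact: f0.
- exact: measurable_tcons.
Qed.

Lemma integral_lebesgue_tupleS_out n (f : tupleR n.+1 -> \bar R) :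
  measurable_fun setT f -> (forall t, 0 <= f t) ->
  \int[lebesgue_tuple n.+1]_t f t =
  \int[lebesgue_measure]_x \int[lebesgue_tuple n]_y f (tcons (x, y)).
Proof.
move=> mf f0; rewrite integral_lebesgue_tupleS//.
rewrite -(fubini_tonelli (f \o tcons))//.
  by apply: (measurableT_comp mf); exact: measurable_tcons.
by move=> t; exact: f0.
Qed.

Lemma measurable_gauss_quad n (L : 'M[R]_n) :
  measurable_fun setT
    (fun x : tupleR n => (expR (- quad L (row_of_tuple x) / 2))%:E).
Proof.
apply/measurable_EFinP; apply: measurableT_comp => //.
apply: measurable_funM => //; apply: measurableT_comp => //.
exact: measurable_quad.
Qed.

Lemma integral_gauss_fiber n (L : 'M[R]_n.+1) (y : tupleR n) : posdefmx L ->
  \int[lebesgue_measure]_x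
    (expR (- quad L (row_of_tuple (tcons (x, y))) / 2))%:E =
  (Num.sqrt (pi *+ 2 / L 0 0) *
   expR (- quad (schur (L : 'M[R]_(1 + n))) (row_of_tuple y) / 2))%:E.
Proof.
move=> posL; have a_gt0 := @posdefmx_diag0 _ n _ posL; case: (posL) => symL _.
pose m := (- ((row_of_tuple y *m (ursubmx (L : 'M[R]_(1 + n)))^T) 0 0 / L 0 0))%R.
pose k := expR (- quad (schur (L : 'M[R]_(1 + n))) (row_of_tuple y) / 2).
rewrite [in RHS]mulrC EFinM -(integral_gauss m a_gt0).
rewrite -ge0_integralZl_EFin ?expR_ge0//; last first.
  apply/measurable_EFinP; apply: measurableT_comp => //.
  apply: measurable_funM => //; apply: measurableT_comp => //.
  apply: measurable_funM => //; apply: measurable_funX.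
  exact: measurable_funB.
apply: eq_integral => x _.
rewrite row_of_tcons (@quad_schur _ n)// ?lt0r_neq0//.
by rewrite -EFinM -expRD addrC /m opprK -mulrDl opprD.
Qed.

Lemma integral_gauss_quad n (L : 'M[R]_n) : posdefmx L ->
  \int[lebesgue_tuple n]_x (expR (- quad L (row_of_tuple x) / 2))%:E =
  (Num.sqrt ((pi *+ 2) ^+ n / \det L))%:E.
Proof.
elim: n L => [|n IH] L posL.
  have quad0 x : quad L x = 0%R by rewrite /quad mxE big_ord0.
  under eq_integral do rewrite quad0 oppr0 mul0r expR0.
  by rewrite integral_dirac// diracT mul1e det_mx00 expr0 invr1 mulr1 sqrtr1.
have a_gt0 := @posdefmx_diag0 _ n _ posL; case: (posL) => symL _.
rewrite integral_lebesgue_tupleS; last 2 first.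
- exact: measurable_gauss_quad.
- by move=> t; rewrite lee_fin expR_ge0.
have pos2pi : (0 <= pi *+ 2 / L 0 0 :> R)%R.
  by rewrite divr_ge0 ?ltW// mulrn_wgt0// pi_gt0.
transitivity (\int[lebesgue_tuple n]_y ((Num.sqrt (pi *+ 2 / L 0 0))%:E *
    (expR (- quad (schur (L : 'M[R]_(1 + n))) (row_of_tuple y) / 2))%:E)).
  by apply: eq_integral => y _; rewrite integral_gauss_fiber.
rewrite ge0_integralZl_EFin//; last first.
  exact: measurable_gauss_quad.
rewrite IH; last exact: (@posdefmx_schur _ n).
rewrite -EFinM -sqrtrM// mulf_div -exprS -(@det_schur _ n)//.
by rewrite lt0r_neq0.
Qed.

Definition hyperplane n (b : 'cV[R]_n) : set (tupleR n) :=
  [set x | (row_of_tuple x *m b) 0%R 0%R = 0%R].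

Lemma measurable_hyperplane n (b : 'cV[R]_n) : measurable (hyperplane b).
Proof.
rewrite -[X in measurable X]setTI.
exact: (measurable_mulmx_coord b 0%R measurableT (measurable_set1 0%R)).
Qed.

(** Either the first coefficient of [b] is nonzero, and the slices along the first
    variable are points, or it is zero, and the slices along the others are
    hyperplanes of one dimension less. *)
Lemma lebesgue_tuple_hyperplane n (b : 'cV[R]_n) : b != 0%R ->
  lebesgue_tuple n (hyperplane b) = 0.
Proof.
elim: n b => [|n IH] b b0.
  by case/eqP: b0; apply/matrixP => -[].
rewrite -[hyperplane b]setIT -integral_indic//; last exact: measurable_hyperplane.
pose c := @dsubmx _ 1 n 1 b; pose a := b 0%R 0%R.
have hE x y : (row_of_tuple (tcons (x, y)) *m b) 0%R 0%R =
    (x * a + (row_of_tuple y *m c) 0%R 0%R)%R.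
  rewrite row_of_tcons -{1}[b](@vsubmxK _ 1 n 1).
  rewrite (@mul_row_col _ 1 1 n 1).
  by rewrite !mxE big_ord1 !mxE eqxx mulr1n lshift0.
have mI : measurable_fun setT (fun t => (\1_(hyperplane b) t)%:E : \bar R).
  by apply/measurable_EFinP; apply: measurable_indic; exact: measurable_hyperplane.
have I0 (t : tupleR n.+1) : 0 <= (\1_(hyperplane b) t)%:E :> \bar R.
  by rewrite lee_fin.
have [a0|a0] := eqVneq a 0%R.
  rewrite integral_lebesgue_tupleS_out// integral0_eq// => x _.
  rewrite (eq_integral (fun y => (\1_(hyperplane c) y)%:E)); last first.
    move=> y _; rewrite !indicE; congr ((_ _)%:R%:E).
    by apply/idP/idP; rewrite !inE /hyperplane/= hE a0 mulr0 add0r.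
  rewrite integral_indic ?setIT//; last exact: measurable_hyperplane.
  apply: IH; apply: contra_neq b0 => c0.
  rewrite -[b](@vsubmxK _ 1 n 1) -/c c0; apply/matrixP => i j.
  rewrite !mxE; case: splitP => k _; rewrite !mxE //.
  by rewrite (ord1 j) (ord1 k) -[RHS]a0 lshift0.
rewrite integral_lebesgue_tupleS// integral0_eq// => y _.
pose z := (- ((row_of_tuple y *m c) 0 0 / a))%R.
rewrite (eq_integral (fun x : measurableTypeR R => (\1_[set z] x)%:E)); last first.
  move=> x _; rewrite !indicE; congr ((_ _)%:R%:E).
  apply/idP/idP; rewrite !inE /hyperplane/= hE.
    by move/eqP; rewrite addrC addr_eq0 => /eqP h; rewrite /z h mulNr mulfK ?opprK.
  by move->; rewrite /z mulNr divfK// addNr.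
by rewrite integral_indic ?setIT//; exact: lebesgue_measure_set1.
Qed.
End lebesgue_tuple_integral.

Section gauss_scaling.
Context {R : realType}.
Local Notation tupleR n := (n.-tuple (measurableTypeR R)).

Lemma sqrtrXn (x : R) k : 0 <= x -> Num.sqrt (x ^+ k) = Num.sqrt x ^+ k.
Proof.
by move=> x0; elim: k => [|k IH]; rewrite ?sqrtr1// !exprS sqrtrM// IH.
Qed.

Variables (k : nat) (L : 'M[R]_k).
Hypothesis posL : posdefmx L.
Let Q (x : tupleR k) := quad L (row_of_tuple x) / 2.

Definition gauss_mass : R := Num.sqrt ((pi *+ 2) ^+ k / \det L).

Let gauss_gt0 : 0 < (pi *+ 2) ^+ k / \det L.
Proof.
by rewrite divr_gt0 ?det_posdefmx_gt0// exprn_gt0// mulrn_wgt0// pi_gt0.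
Qed.

Let gauss_ge0 := ltW gauss_gt0.

Lemma gauss_mass_gt0 : 0 < gauss_mass.
Proof. by rewrite sqrtr_gt0. Qed.

(** Scaling the exponent by [a] scales the integral by [a ^ (- k / 2)]; this takes
    the place of a linear change of variables. *)
Lemma integral_expR_quad a : 0 < a ->
  (\int[lebesgue_tuple k]_x (expR (- (a * Q x)))%:E)%E =
  (gauss_mass * Num.sqrt a^-1 ^+ k)%:E.
Proof.
move=> a0; transitivity ((\int[lebesgue_tuple k]_x
    (expR (- quad (a *: L) (row_of_tuple x) / 2))%:E)%E).
  by apply: eq_integral => x _; rewrite quadZ -mulNr -mulNr mulrA.
rewrite integral_gauss_quad; last exact: posdefmxZ.
rewrite detZ invfM -exprVn mulrCA mulrC sqrtrM ?gauss_ge0//.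
by rewrite sqrtrXn// invr_ge0 ltW.
Qed.

Lemma integrable_expR_quad a : 0 < a ->
  (lebesgue_tuple k).-integrable setT (EFin \o (fun x => expR (- (a * Q x)))).
Proof.
move=> a0; apply/integrableP; split.
  apply/measurable_EFinP; apply: measurableT_comp => //.
  apply: measurableT_comp => //; apply: measurable_funM => //.
  by apply: measurable_funM => //; exact: measurable_quad.
under eq_integral do rewrite /= ger0_norm ?expR_ge0//.
by rewrite integral_expR_quad// ltry.
Qed.

Lemma Rintegral_expR_quad a : 0 < a ->
  \int[lebesgue_tuple k]_x expR (- (a * Q x)) = gauss_mass * Num.sqrt a^-1 ^+ k.
Proof. by move=> a0; rewrite /Rintegral integral_expR_quad. Qed.

Lemma mvnormal_probE (a : R) A : 0 < a -> measurable A ->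
  mvnormal_prob 0 (a^-1 *: invmx L) A =
  ((\int[lebesgue_tuple k]_x expR (- (a * Q x)))^-1 *
   \int[lebesgue_tuple k]_(x in A) expR (- (a * Q x)))%:E.
Proof.
move=> a0 mA; have uL := posdefmx_unit posL.
have uLa : a *: L \in unitmx by rewrite unitmxZ ?unitfE ?lt0r_neq0.
have iA : (lebesgue_tuple k).-integrable A (EFin \o (fun x => expR (- (a * Q x)))).
  by apply: integrableS (integrable_expR_quad a0).
rewrite -RintegralZl//; rewrite /mvnormal_prob /Rintegral fineK; last first.
  apply: integrable_fin_num => //.
  exact: (integrableZl mA _ iA).
apply: eq_integral => x _; congr (_%:E); rewrite /mvnormal_pdf subr0.
rewrite -invmxZ// det_inv invmxK; congr (_^-1 * expR _); last first.
  by rewrite -/(quad _ _) quadZ mulNr -mulrA.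
have := integral_expR_quad a0; rewrite -sqrtrXn ?invr_ge0 ?(ltW a0)//.
rewrite -sqrtrM// => ->; rewrite /= detZ exprVn; congr Num.sqrt.
by rewrite invfM mulrA mulrAC.
Qed.
End gauss_scaling.

(** * Total variation distance of normalized densities *)

Section total_variation.
Context d (T : measurableType d) (R : realType).
Variable mu : {measure set T -> \bar R}.

Lemma tv_dist_ge0 (P Q : set T -> \bar R) : (0 <= tv_dist P Q)%E.
Proof.
apply: le_trans (ereal_sup_ubound _); first exact: (abse_ge0 (P set0 - Q set0)%E).
by exists set0.
Qed.

(** The factor 2 accounts for the two normalizations: the masses of [w] and [v]
    differ by at most the L1 distance of [w] and [v] as well. *)
Lemma tv_dist_normalized (w v : T -> R) (e : R) (P Q : set T -> \bar R) :
  (forall x, 0 <= w x) -> (forall x, 0 <= v x) ->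
  mu.-integrable setT (EFin \o w) -> mu.-integrable setT (EFin \o v) ->
  0 < \int[mu]_x w x -> 0 < \int[mu]_x v x ->
  \int[mu]_x `|w x - v x| <= e * \int[mu]_x v x ->
  (forall A, measurable A ->
    P A = ((\int[mu]_x w x)^-1 * \int[mu]_(x in A) w x)%:E) ->
  (forall A, measurable A ->
    Q A = ((\int[mu]_x v x)^-1 * \int[mu]_(x in A) v x)%:E) ->
  (tv_dist P Q <= (2 * e)%:E)%E.
Proof.
move=> w0 v0 iw iv W0 V0 wv PE QE; apply: ge_ereal_sup => _ [A mA <-].
rewrite PE// QE// -EFinB abse_EFin lee_fin.
set W := \int[mu]_x w x in W0 PE *; set V := \int[mu]_x v x in V0 QE wv *.
have iA (f : T -> R) : mu.-integrable setT (EFin \o f) ->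
    mu.-integrable A (EFin \o f).
  exact: integrableS.
have id : mu.-integrable setT (EFin \o (fun x => w x - v x)).
  have -> : EFin \o (fun x => w x - v x) = ((EFin \o w) \- (EFin \o v))%E by [].
  exact: integrableB.
have idn : mu.-integrable setT (EFin \o (fun x => `|w x - v x|)).
  exact: integrable_norm.
have leA (f : T -> R) : mu.-integrable setT (EFin \o f) ->
    (forall x, 0 <= f x) -> \int[mu]_(x in A) f x <= \int[mu]_x f x.
  move=> fi f0; rewrite Rintegral_mkcond; apply: le_Rintegral => //.
    by rewrite -restrict_EFin; apply/integrable_restrict => //; rewrite setTI; exact: iA.
  by move=> x _; rewrite /patch; case: ifP.
have dA : `|\int[mu]_(x in A) w x - \int[mu]_(x in A) v x| <= e * V.
  rewrite -RintegralB ?iA//; apply: le_trans (le_normr_Rintegral mA _) _ => /=.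
    exact: iA.
  by apply: le_trans wv; apply: leA.
have dT : `|W - V| <= e * V.
  by rewrite -RintegralB//; apply: le_trans (le_normr_Rintegral measurableT _) _.
set a := \int[mu]_(x in A) w x in dA *; set b := \int[mu]_(x in A) v x in dA *.
have aW : a <= W by exact: leA.
have a0 : 0 <= a by apply: Rintegral_ge0.
have -> : W^-1 * a - V^-1 * b = V^-1 * ((a / W) * (V - W) + (a - b)).
  by field; rewrite !lt0r_neq0.
rewrite normrM gtr0_norm ?invr_gt0// mulrC ler_pdivrMr//.
apply: le_trans (ler_normD _ _) _; have -> : 2 * e * V = e * V + e * V by ring.
apply: lerD => //.
rewrite normrM distrC; apply: le_trans dT; rewrite ler_piMl//.
by rewrite ger0_norm ?(divr_ge0 a0 (ltW W0))// ler_pdivrMr// mul1r.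
Qed.
End total_variation.

(** * The remainder function of x ln x *)

Section bennett.
Context {R : realType}.
Implicit Types t a b K : R.

(** Bennett's function, the large deviation rate function of a centred Poisson
    variable of parameter 1; [q * bennett (p / q)] is the Bregman remainder of
    [x ln x] between [q] and [q + p]. *)
Definition bennett t : R := (1 + t) * ln (1 + t) - t.

Lemma ge_ln1Dx t : -1 < t -> t / (1 + t) <= ln (1 + t).
Proof.
move=> t1; have p : 0 < 1 + t by lra.
have /le_ln1Dx : -1 < (1 + t)^-1 - 1 by rewrite ltrBrDr addNr invr_gt0.
rewrite subrKC lnV ?posrE// lerNl opprB.
suff -> : t / (1 + t) = 1 - (1 + t)^-1 by [].
by field; rewrite lt0r_neq0.
Qed.

Let is_derive_gap a t : -1 < t ->
  is_derive t 1 (fun s => bennett s - a * (s ^+ 2 / 2)) (ln (1 + t) - a * t).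
Proof.
move=> t1; have p : 0 < 1 + t by lra.
have dl : is_derive t 1 (fun s => ln (1 + s)) (1 + t)^-1.
  have h1 : is_derive (1 + t) 1 (@ln R) (1 + t)^-1 by exact: is_derive1_ln.
  apply: (@is_derive_eq _ _ _ _ _ _ _ _ (is_derive1_comp _ _)).
  by rewrite add0r mulr1.
rewrite /bennett; apply: is_derive_eq.
rewrite /GRing.scale/= !(mulr1, mulr0, addr0, add0r, expr1).
by field; rewrite lt0r_neq0.
Qed.

Let gap_MVT a t : -1 < t -> exists2 th : R, 0 <= th <= 1 &
  bennett t - a * (t ^+ 2 / 2) = (ln (1 + th * t) - a * (th * t)) * t.
Proof.
move=> t1; pose F s := bennett s - a * (s ^+ 2 / 2).
have F0 : F 0 = 0 by rewrite /F /bennett addr0 ln1 mulr0 expr0n/= mul0r mulr0 !subr0.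
have FMVT x y : -1 < x -> x < y -> exists2 c, c \in `]x, y[%R &
    F y - F x = (ln (1 + c) - a * c) * (y - x).
  move=> x1 xy; apply: MVT => // [z|].
    by rewrite in_itv/= => /andP[xz _]; apply: is_derive_gap; exact: lt_trans xz.
  apply: derivable_within_continuous => z; rewrite in_itv/= => /andP[xz _].
  by apply: ex_derive; apply: is_derive_gap; exact: lt_le_trans xz.
have [t0|t0|->] := ltrgtP t 0.
- have [c] := FMVT _ _ t1 t0; rewrite in_itv/= => /andP[tc c0].
  rewrite F0 !sub0r mulrN => /oppr_inj Ft; exists (c / t).
    by rewrite ler_ndivrMr// ler_ndivlMr// mul0r mul1r !ltW.
  by rewrite divfK ?lt_eqF.
- have [c] := FMVT _ _ (ltrN10 R) t0; rewrite in_itv/= => /andP[c0 ct].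
  rewrite F0 !subr0 => Ft; exists (c / t).
    by rewrite ler_pdivrMr// ler_pdivlMr// mul0r mul1r !ltW.
  by rewrite divfK ?gt_eqF.
- by exists 0; [rewrite lexx ler01|rewrite -/(F 0) F0 mulr0].
Qed.

(** On [-1 < t <= K] the second derivative [(1 + t)^-1] of [bennett] is at
    least [(1 + K)^-1]. At [t = -1] the mean value theorem does not apply, and the bound
    is computed from [ln 0 = 0]. *)
Lemma bennett_ge K t : -1 <= t <= K -> 0 <= K -> t ^+ 2 / 2 / (1 + K) <= bennett t.
Proof.
move=> /andP[t1 tK] K0; have K1 : 0 < 1 + K by lra.
have a1 : (1 + K)^-1 <= 1 by rewrite invf_le1//; lra.
move: t1; rewrite le_eqVlt => /predU1P[<-|t1].
  by rewrite /bennett subrr mul0r sub0r sqrrN expr1n; lra.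
rewrite mulrC -subr_ge0; have [th /andP[th0 th1] ->] := gap_MVT (1 + K)^-1 t1.
have [t0|t0] := leP 0 t.
  apply: mulr_ge0 => //; rewrite subr_ge0.
  have s0 : 0 <= th * t by exact: mulr_ge0.
  have st : th * t <= t by exact: ler_piMl.
  apply: le_trans (ge_ln1Dx _); last by lra.
  by rewrite mulrC ler_wpM2l// lef_pV2 ?posrE; lra.
apply: mulr_le0; last exact: ltW.
have s0 : th * t <= 0 by rewrite mulr_ge0_le0// ltW.
have st : t <= th * t by rewrite ler_niMl// ltW.
rewrite subr_le0; apply: le_trans (le_ln1Dx _) _; first by lra.
by rewrite ler_niMl.
Qed.

(** To the right of [- K] the second derivative is at most [(1 - K)^-1]. *)
Lemma bennett_le K t : 0 <= K < 1 -> - K <= t -> bennett t <= t ^+ 2 / 2 / (1 - K).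
Proof.
move=> /andP[K0 K1] tK; have K1' : 0 < 1 - K by lra.
have a1 : 1 <= (1 - K)^-1 by rewrite invf_ge1//; lra.
have t1 : -1 < t by lra.
rewrite [leRHS]mulrC -subr_le0; have [th /andP[th0 th1] ->] := gap_MVT (1 - K)^-1 t1.
have [t0|t0] := leP 0 t.
  apply: mulr_le0_ge0 => //; rewrite subr_le0.
  have s0 : 0 <= th * t by exact: mulr_ge0.
  apply: le_trans (le_ln1Dx _) _; first by lra.
  by rewrite ler_peMl.
apply: mulr_ge0_le0; last exact: ltW.
have s0 : th * t <= 0 by rewrite mulr_ge0_le0// ltW.
have st : t <= th * t by rewrite ler_niMl// ltW.
rewrite subr_ge0; apply: le_trans (ge_ln1Dx _); last by lra.
by rewrite mulrC ler_wnM2l// lef_pV2 ?posrE; lra.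
Qed.
End bennett.

(** * The I-divergence around an I-projection *)

Section Iprojection.
Context {R : realType}.

Lemma bennett_ge0 (t : R) : -1 <= t -> 0 <= bennett t.
Proof.
move=> t1; have := bennett_ge (K := `|t|) (t := t).
rewrite t1 ler_norm => /(_ isT (normr_ge0 _)); apply: le_trans.
by rewrite divr_ge0// ?addr_ge0// divr_ge0// sqr_ge0.
Qed.

Lemma xlnx_expand (r q p : R) : 0 < r -> 0 < q -> 0 <= q + p ->
  (q + p) * ln ((q + p) / r) =
  q * ln (q / r) + p * ln (q / r) + p + q * bennett (p / q).
Proof.
move=> r0 q0; rewrite le_eqVlt => /predU1P[qp|qp].
  have -> : p = - q by apply/eqP; rewrite -addr_eq0 addrC -qp.
  have -> : - q / q = -1 by rewrite mulNr divff// lt0r_neq0.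
  by rewrite /bennett !subrr !mul0r; ring.
have E : 1 + p / q = (q + p) / q by field; rewrite lt0r_neq0.
have -> : (q + p) / r = (q / r) * (1 + p / q).
  by rewrite E; field; rewrite !lt0r_neq0.
rewrite lnM ?posrE ?divr_gt0// ?E ?divr_gt0// /bennett E.
by field; rewrite !lt0r_neq0.
Qed.

Lemma xlnx_tangent (r m s : R) : 0 < r -> 0 < m -> 0 <= s ->
  m * ln (m / r) + (s - m) * (ln (m / r) + 1) <= s * ln (s / r).
Proof.
move=> r0 m0 s0; have := @xlnx_expand r m (s - m) r0 m0.
rewrite subrKC => /(_ s0) ->.
have : 0 <= m * bennett ((s - m) / m).
  by rewrite mulr_ge0 ?(ltW m0)// bennett_ge0// ler_pdivlMr//; lra.
lra.
Qed.

Lemma xlnx_convex (r a b t : R) : 0 < r -> 0 <= a -> 0 <= b -> 0 <= t <= 1 ->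
  (a + t * (b - a)) * ln ((a + t * (b - a)) / r) <=
  (1 - t) * (a * ln (a / r)) + t * (b * ln (b / r)).
Proof.
move=> r0 a0 b0 /andP[t0 t1]; set m := a + t * (b - a).
have mE : m = (1 - t) * a + t * b by rewrite /m; ring.
have t1' : 0 <= 1 - t by rewrite subr_ge0.
have : 0 <= m by rewrite mE addr_ge0// mulr_ge0.
rewrite le_eqVlt => /predU1P[m0|m0].
  have /eqP : (1 - t) * a + t * b = 0 by rewrite -mE.
  rewrite paddr_eq0 ?mulr_ge0// => /andP[/eqP ta /eqP tb].
  by rewrite -m0 !mulrA ta tb !mul0r addr0.
have ha := ler_wpM2l t1' (xlnx_tangent r0 m0 a0).
have hb := ler_wpM2l t0 (xlnx_tangent r0 m0 b0).
apply: le_trans (lerD ha hb); rewrite le_eqVlt; apply/orP; left; apply/eqP.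
set l := ln _; have e : (1 - t) * (a - m) + t * (b - m) = 0 by rewrite mE; ring.
rewrite -[LHS]addr0 -(mulr0 (l + 1)) -e; ring.
Qed.

Variable n : nat.
Implicit Types (p q r : 'rV[R]_n) (C : set 'rV[R]_n).

Lemma Idiv_expand r q p : (forall j, 0 < r 0 j) -> (forall j, 0 <= q 0 j) ->
  (forall j, q 0 j = 0 -> p 0 j = 0) -> (forall j, 0 <= q 0 j + p 0 j) ->
  \sum_j p 0 j = 0 ->
  Idiv (q + p) r = Idiv q r + \sum_j p 0 j * ln (q 0 j / r 0 j)
    + \sum_j q 0 j * bennett (p 0 j / q 0 j).
Proof.
move=> r0 q0 qp qp0 p0; rewrite -[RHS]addr0 -[in X in _ = _ + X]p0 /Idiv.
rewrite -!big_split/=.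
apply: eq_bigr => j _; rewrite !mxE.
have := q0 j; rewrite le_eqVlt => /predU1P[q00|qj].
  by rewrite qp// -q00 !(mul0r, addr0).
by rewrite xlnx_expand//; ring.
Qed.

(** If [q 0 j = 0], the step [t] towards [p] raises the divergence by at most a
    multiple of [t] plus [t * p 0 j * ln t], and the latter dominates for small
    [t]. *)
Lemma Iprojection_support r C q p j : (forall j, 0 < r 0 j) ->
  C `<=` simplex -> is_Iprojection r C q -> C p ->
  (forall t, 0 < t < 1 -> C (q + t *: (p - q))) ->
  0 < p 0 j -> 0 < q 0 j.
Proof.
move=> r0 Csub [Cq minq] Cp seg pj.
have [q0 _] := Csub _ Cq; have [p0 _] := Csub _ Cp.
rewrite lt0r q0 andbT; apply/eqP => qj.
(* [K] is chosen so that [p 0 j * ln t] is below [- `|Idiv q r - Idiv p r|]. *)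
pose K := (`|Idiv q r - Idiv p r| + 1) / p 0 j; pose t := expR (- K).
have K0 : 0 < K by rewrite divr_gt0// ltr_pwDr.
have t01 : 0 < t < 1 by rewrite expR_gt0 expR_lt1 oppr_lt0.
have t0 : 0 < t by case/andP: t01.
have : Idiv (q + t *: (p - q)) r <=
    (1 - t) * Idiv q r + t * Idiv p r + t * (p 0 j * ln t).
  have -> : t * (p 0 j * ln t) =
      \sum_i (if i == j then t * (p 0 j * ln t) else 0).
    by rewrite -big_mkcond big_pred1_eq.
  rewrite /Idiv !mulr_sumr -!big_split/=; apply: ler_sum => i _.
  rewrite !mxE; case: eqP => [->|_]; last first.
    by rewrite addr0 xlnx_convex//; case/andP: t01 => *; rewrite !ltW.
  rewrite qj add0r subr0 mul0r mulr0 add0r -[t * p 0 j / r 0 j]mulrA.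
  rewrite lnM ?posrE ?divr_gt0//.
  by rewrite le_eqVlt; apply/orP; left; apply/eqP; ring.
move/(le_trans (minq _ (seg _ t01))).
rewrite /t expRK -/t => h.
have pK : p 0 j * - K = - (`|Idiv q r - Idiv p r| + 1).
  by rewrite /K; field; rewrite lt0r_neq0.
rewrite pK in h.
have : t * (Idiv q r - Idiv p r) <= t * - (`|Idiv q r - Idiv p r| + 1).
  by lra.
rewrite ler_pM2l//; have := ler_norm (- (Idiv q r - Idiv p r)); rewrite normrN.
by move: (`|_|) => N; lra.
Qed.

(** Along a direction in which [q] can be moved both ways, the divergence is at
    most [s * L + s ^ 2 * K] above its minimum, [L] being the derivative at [q];
    a nonnegative function of this kind near [s = 0] has [L = 0]. *)
Lemma Iprojection_stationary r C q p : (forall j, 0 < r 0 j) ->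
  C `<=` simplex -> is_Iprojection r C q ->
  (forall j, q 0 j = 0 -> p 0 j = 0) -> \sum_j p 0 j = 0 ->
  (forall s, (forall j, `|s * p 0 j| <= q 0 j / 2) -> C (q + s *: p)) ->
  \sum_j p 0 j * ln (q 0 j / r 0 j) = 0.
Proof.
move=> r0 Csub [Cq minq] qp sp inC; set L := \sum_j _.
have [q0 _] := Csub _ Cq.
pose m := \sum_j `|p 0 j| / q 0 j; pose K := \sum_j p 0 j ^+ 2 / q 0 j.
have m0 : 0 <= m by apply: sumr_ge0 => j _; rewrite divr_ge0.
have K0 : 0 <= K by apply: sumr_ge0 => j _; rewrite divr_ge0// sqr_ge0.
(* The step [s = - L / d] is small enough both for [q + s p] to stay in [C] (the
   summand [2 |L| m]) and for the quadratic term not to offset the linear one (the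
   summand [K]). *)
pose d := 2 * `|L| * m + K + 1.
have d0 : 0 < d by rewrite /d ltr_pwDr// addr_ge0// !mulr_ge0.
pose s := - (L / d).
have sq j : `|s * p 0 j| <= q 0 j / 2.
  have pm : `|p 0 j| <= m * q 0 j.
    have := q0 j; rewrite le_eqVlt => /predU1P[qj|qj].
      by rewrite qp// -qj normr0 mulr0.
    rewrite -ler_pdivrMr// /m (bigD1 j)//= lerDl.
    by apply: sumr_ge0 => i _; rewrite divr_ge0.
  rewrite normrM normrN normrM normfV (gtr0_norm d0) mulrAC ler_pdivrMr//.
  apply: le_trans (ler_wpM2l (normr_ge0 L) pm) _.
  have : 0 <= q 0 j / 2 * (K + 1) by rewrite mulr_ge0// ?divr_ge0// ?addr_ge0.
  by rewrite /d; lra.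
have sgt0 j : 0 <= q 0 j + (s *: p) 0 j.
  rewrite mxE; have := sq j; rewrite ler_norml => /andP[+ _].
  by have := q0 j; lra.
have := minq _ (inC s sq); rewrite Idiv_expand//; last 2 first.
- by move=> j /qp; rewrite mxE => ->; rewrite mulr0.
- by under eq_bigr do rewrite mxE; rewrite -mulr_sumr sp mulr0.
rewrite -addrA lerDl.
have -> : \sum_j (s *: p) 0 j * ln (q 0 j / r 0 j) = s * L.
  by rewrite /L mulr_sumr; apply: eq_bigr => j _; rewrite mxE mulrA.
have : \sum_j q 0 j * bennett ((s *: p) 0 j / q 0 j) <= s ^+ 2 * K.
  rewrite /K mulr_sumr; apply: ler_sum => j _; rewrite mxE.
  have := q0 j; rewrite le_eqVlt => /predU1P[<-|qj].
    by rewrite mul0r invr0 !mulr0.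
  have h : - (2^-1) <= s * p 0 j / q 0 j.
    rewrite ler_pdivlMr//; have := sq j; rewrite ler_norml => /andP[+ _].
    lra.
  have K1 : (0 <= 2^-1 :> R) && (2^-1 < 1 :> R) by apply/andP; split; lra.
  have hc := bennett_le K1 h.
  apply: le_trans (ler_wpM2l (ltW qj) hc) _.
  by rewrite le_eqVlt; apply/orP; left; apply/eqP; field; rewrite lt0r_neq0.
move=> h1 h2; have {h1 h2} : 0 <= s * L + s ^+ 2 * K by lra.
have -> : s * L + s ^+ 2 * K = - (L ^+ 2 * ((d - K) / d ^+ 2)).
  by rewrite /s; field; rewrite lt0r_neq0.
rewrite oppr_ge0 pmulr_lle0; last first.
  rewrite divr_gt0 ?exprn_gt0// /d; have : 0 <= 2 * `|L| * m by rewrite !mulr_ge0.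
  lra.
by move=> L2; apply/eqP; rewrite -sqrf_eq0 eq_le L2 sqr_ge0.
Qed.
End Iprojection.

(** * Laplace's method with Gaussian bounds *)

Section laplace.
Context {R : realType}.
Local Notation tupleR n := (n.-tuple (measurableTypeR R)).

(** The pointwise comparison behind Laplace's method, [y] being the value of the
    quadratic form and [w] that of the density. For [y < d] the density and
    [exp (- N y)] both lie between the two exponentials; for [d <= y] both are below
    [exp (- N c y)], half of whose exponent provides the exponentially small
    factor. *)
Lemma expR_sandwich (N a b c d y w : R) : 0 < N -> a <= 1 <= b -> 0 < c <= 1 ->
  0 <= y -> (y < d -> expR (- (N * b * y)) <= w <= expR (- (N * a * y))) ->
  0 <= w <= expR (- (N * c * y)) ->
  `|w - expR (- (N * y))| <= expR (- (N * a * y)) - expR (- (N * b * y)) +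
    expR (- (N * c * d / 2)) * expR (- (N * (c / 2) * y)).
Proof.
move=> N0 /andP[a1 b1] /andP[c0 c1] y0 near_ /andP[w0 wc].
have Ny : 0 <= N * y by rewrite mulr_ge0// ltW.
have hb : expR (- (N * b * y)) <= expR (- (N * y)).
  by rewrite ler_expR lerN2 mulrAC ler_peMr.
have ha : expR (- (N * y)) <= expR (- (N * a * y)).
  by rewrite ler_expR lerN2 mulrAC ler_piMr.
rewrite -expRD; have [yd|yd] := ltP y d.
  have /andP[bw wa] := near_ yd; rewrite -[leLHS]addr0 lerD ?expR_ge0//.
  by rewrite ler_norml; apply/andP; split; lra.
rewrite -[leLHS]add0r lerD//; first by lra.
have hc : expR (- (N * y)) <= expR (- (N * c * y)).
  by rewrite ler_expR lerN2 mulrAC ler_piMr.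
apply: (@le_trans _ _ (expR (- (N * c * y)))).
  by have := expR_ge0 (- (N * y)); rewrite ler_norml => h; apply/andP; split; lra.
rewrite ler_expR; have := ler_wpM2l (ltW (mulr_gt0 N0 c0)) yd; lra.
Qed.

Lemma sqrt_gap_small k (e : R) : 0 < e -> exists2 d : R, 0 < d < 1 &
  Num.sqrt (1 + d) ^+ k - Num.sqrt (1 - d) ^+ k <= e.
Proof.
move=> e0; pose F (d : R) : R := Num.sqrt (1 + d) ^+ k - Num.sqrt (1 - d) ^+ k.
have cF : {for 0, continuous F}.
  apply: continuousB.
  - apply: (@continuous_comp _ _ _ (fun d : R => Num.sqrt (1 + d)) (fun x => x ^+ k)).
      apply: (@continuous_comp _ _ _ (fun d : R => 1 + d) Num.sqrt).
        by apply: continuousD; [exact: cvg_cst|exact: cvg_id].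
      exact: sqrt_continuous.
    exact: exprn_continuous.
  - apply: (@continuous_comp _ _ _ (fun d : R => Num.sqrt (1 - d)) (fun x => x ^+ k)).
      apply: (@continuous_comp _ _ _ (fun d : R => 1 - d) Num.sqrt).
        by apply: continuousB; [exact: cvg_cst|exact: cvg_id].
      exact: sqrt_continuous.
    exact: exprn_continuous.
have F0 : F 0 = 0 by rewrite /F addr0 subr0 subrr.
have {cF} : F d @[d --> 0^'+] --> 0.
  by rewrite -[X in _ --> X]F0; apply: cvg_at_right_filter; exact: cF.
move/cvgrPdist_le => /(_ _ e0) H.
near (0 : R)^'+ => d; exists d.
  by apply/andP; split; near: d; [exact: nbhs_right_gt|exact: nbhs_right_lt].
have : `|0 - F d| <= e by near: d.
by rewrite sub0r normrN; apply: le_trans; exact: ler_norm.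
Unshelve. all: by end_near. Qed.

Lemma expR_decay_small (c s e : R) : 0 < c -> 0 <= s -> 0 < e ->
  \forall N \near \oo, expR (- (N%:R * c)) * s <= e.
Proof.
move=> c0 s0 e0; near=> N.
have Ns : s / (c * e) <= N%:R by near: N; exact: nbhs_infty_ger.
have h : s <= N%:R * c * e by rewrite -mulrA -ler_pdivrMr// mulr_gt0.
rewrite expRN mulrC ler_pdivrMr ?expR_gt0//; apply: le_trans h _.
rewrite mulrC ler_wpM2l ?ltW//; have := expR_ge1Dx (N%:R * c).
by move: (expR _) => E; lra.
Unshelve. all: by end_near. Qed.

(** The integral of each Gaussian bound of [expR_sandwich] is a constant multiple
    of the mass [V] of [exp (- N Q)], the constants being
    [(1 + d) ^ (k / 2)], [(1 - d) ^ (k / 2)] and [(c / 2) ^ (- k / 2)]: first [d] and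
    then [N] are chosen to make the total small. *)
Theorem laplace_tv k (L : 'M[R]_k) (dom : set (tupleR k)) (g : tupleR k -> R)
    (c : R) (P : nat -> set (tupleR k) -> \bar R) :
  let Q x := quad L (row_of_tuple x) / 2 in
  let w N := (fun x => expR (- (N%:R * g x))) \_ dom in
  posdefmx L -> measurable dom -> measurable_fun setT g -> 0 < c <= 1 ->
  (forall x, dom x -> c * Q x <= g x) ->
  (forall d, 0 < d < 1 -> exists2 e, 0 < e & forall x, Q x < e ->
     dom x /\ Q x / (1 + d) <= g x <= Q x / (1 - d)) ->
  (forall N, (0 < \int[lebesgue_tuple k]_x (w N x)%:E)%E) ->
  (forall N A, measurable A -> P N A =
     ((fine (\int[lebesgue_tuple k]_x (w N x)%:E))^-1%:E *
      \int[lebesgue_tuple k]_(x in A) (w N x)%:E)%E) ->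
  tv_dist (P N) (mvnormal_prob 0 (N%:R^-1 *: invmx L)) @[N --> \oo] --> 0%E.
Proof.
move=> Q w posL mdom mg c01 gc gloc W0 PE; case/andP: (c01) => c0 c1.
have Q0 x : 0 <= Q x by rewrite divr_ge0// quad_ge0.
have w0 N x : 0 <= w N x by rewrite /w /patch; case: ifP => // _; exact: expR_ge0.
have wc N x : w N x <= expR (- (N%:R * c * Q x)).
  rewrite /w /patch; case: ifPn => [|_]; last exact: expR_ge0.
  by rewrite inE => /gc h; rewrite ler_expR lerN2 -mulrA ler_wpM2l.
have mw N : measurable_fun setT (w N).
  apply/(measurable_restrictT _ mdom); apply: measurable_funTS.
  apply: measurableT_comp => //; apply: measurableT_comp => //.
  exact: measurable_funM.
have iw N : (0 < N)%N -> (lebesgue_tuple k).-integrable setT (EFin \o w N).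
  move=> N0; have Nc : 0 < N%:R * c by rewrite mulr_gt0 ?ltr0n.
  apply: le_integrable (integrable_expR_quad posL Nc) => //.
    exact/measurable_EFinP.
  by move=> x _; rewrite /= lee_fin !ger0_norm ?expR_ge0//; exact: wc.
suff main e : 0 < e -> \forall N \near \oo,
    (tv_dist (P N) (mvnormal_prob 0 (N%:R^-1 *: invmx L)) <= e%:E)%E.
  have tvfin N e : (tv_dist (P N) (mvnormal_prob 0 (N%:R^-1 *: invmx L)) <= e%:E)%E ->
      tv_dist (P N) (mvnormal_prob 0 (N%:R^-1 *: invmx L)) \is a fin_num.
    by move=> h; rewrite ge0_fin_numE ?tv_dist_ge0//; exact: le_lt_trans h (ltry _).
  apply/fine_cvgP; split; first by near=> N; apply: (tvfin N 1); near: N; exact: main.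
  apply/cvgrPdist_le => e e0; near=> N.
  have h : (tv_dist (P N) (mvnormal_prob 0 (N%:R^-1 *: invmx L)) <= e%:E)%E.
    by near: N; exact: main.
  rewrite sub0r normrN ger0_norm ?fine_ge0 ?tv_dist_ge0//=.
  by rewrite -lee_fin fineK//; exact: tvfin h.
move=> e0; have e4 : 0 < e / 4 by rewrite divr_gt0.
have [d d01 gap] := sqrt_gap_small k e4.
have [r r0 loc] := gloc d d01; case/andP: d01 => d0 d1.
pose s := Num.sqrt (c / 2)^-1 ^+ k.
have s0 : 0 <= s by rewrite exprn_ge0.
have cr0 : 0 < c * r / 2 by rewrite divr_gt0// mulr_gt0.
near=> N.
have N0 : (0 < N)%N by near: N; exact: nbhs_infty_gt.
have NR0 : 0 < N%:R :> R by rewrite ltr0n.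
pose V := \int[lebesgue_tuple k]_x expR (- (N%:R * Q x)).
have VE a : 0 < a -> \int[lebesgue_tuple k]_x expR (- (N%:R * a * Q x)) =
    V * Num.sqrt a^-1 ^+ k.
  move=> a0; rewrite /V !Rintegral_expR_quad ?mulr_gt0//.
  rewrite -mulrA; congr (_ * _); rewrite -exprMn -sqrtrM ?invr_ge0 ?ltW//.
  by rewrite invfM.
have V0 : 0 < V.
  rewrite /V Rintegral_expR_quad// mulr_gt0 ?gauss_mass_gt0// exprn_gt0//.
  by rewrite sqrtr_gt0 invr_gt0.
have a0 : 0 < (1 + d)^-1 by rewrite invr_gt0 addr_gt0.
have b0 : 0 < (1 - d)^-1 by rewrite invr_gt0 subr_gt0.
have c20 : 0 < c / 2 by rewrite divr_gt0.
have bnd x : `|w N x - expR (- (N%:R * Q x))| <=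
    expR (- (N%:R * (1 + d)^-1 * Q x)) - expR (- (N%:R * (1 - d)^-1 * Q x)) +
    expR (- (N%:R * c * r / 2)) * expR (- (N%:R * (c / 2) * Q x)).
  apply: expR_sandwich => //.
  - by rewrite invf_le1 ?invf_ge1 ?subr_gt0 ?addr_gt0//; apply/andP; split; lra.
  - move=> /loc[dx /andP[gl gu]]; rewrite /w /patch mem_set// !ler_expR !lerN2.
    rewrite -!mulrA !ler_pM2l// [_^-1 * _]mulrC gu.
    by rewrite [_^-1 * _]mulrC gl.
  - by rewrite w0 wc.
have -> : e = 2 * (e / 2) by lra.
apply: (@tv_dist_normalized _ _ _ (lebesgue_tuple k) (w N)
    (fun x => expR (- (N%:R * Q x)))) => //.
- exact: iw.
- exact: integrable_expR_quad.
- rewrite /Rintegral fine_gt0// W0/= -ge0_fin_numE; last exact/ltW/W0.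
  exact: integrable_fin_num (iw _ N0).
- have iE a : 0 < a -> (lebesgue_tuple k).-integrable setT
      (EFin \o (fun x => expR (- (N%:R * a * Q x)))).
    by move=> a0'; apply: integrable_expR_quad => //; rewrite mulr_gt0.
  have iC : (lebesgue_tuple k).-integrable setT
      (EFin \o (fun x => expR (- (N%:R * c * r / 2)) * expR (- (N%:R * (c / 2) * Q x)))).
    exact: (integrableZl measurableT _ (iE _ c20)).
  have iB : (lebesgue_tuple k).-integrable setT
      (EFin \o (fun x => expR (- (N%:R * (1 + d)^-1 * Q x)) -
                         expR (- (N%:R * (1 - d)^-1 * Q x)))).
    exact: (integrableB measurableT (iE _ a0) (iE _ b0)).
  apply: (@le_trans _ _ (\int[lebesgue_tuple k]_x
    (expR (- (N%:R * (1 + d)^-1 * Q x)) - expR (- (N%:R * (1 - d)^-1 * Q x)) +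
    expR (- (N%:R * c * r / 2)) * expR (- (N%:R * (c / 2) * Q x))))).
    apply: le_Rintegral => //.
    + apply: integrable_norm.
      exact: (integrableB measurableT (iw _ N0) (integrable_expR_quad posL NR0)).
    + exact: (integrableD measurableT iB iC).
  rewrite RintegralD//.
  rewrite RintegralB; [|exact: measurableT|exact: iE|exact: iE].
  rewrite RintegralZl; [|exact: measurableT|exact: iE].
  rewrite (VE _ a0) (VE _ b0) (VE _ c20) !invrK -/s.
  have dec : expR (- (N%:R * (c * r / 2))) * s <= e / 4.
    by near: N; exact: expR_decay_small.
  have -> : N%:R * c * r / 2 = N%:R * (c * r / 2) by rewrite !mulrA.
  rewrite -/V -mulrBr mulrCA -mulrDr mulrC ler_wpM2r ?(ltW V0)//.
  by apply: le_trans (lerD gap dec) _; lra.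
- move=> A mA; rewrite PE// EFinM fineK//.
  by apply: integrable_fin_num => //; apply: integrableS (iw _ N0).
- by move=> A mA; rewrite mvnormal_probE.
Unshelve. all: by end_near. Qed.
End laplace.

(** * Fluctuations around the I-projection *)

Section fluctuations.
Context {R : realType} {n D : nat}.
Variables (r f : 'rV[R]_n) (M : 'M[R]_(D, n)) (q : 'rV[R]_n).
Hypothesis r_gt0 : forall j, 0 < r 0 j.
Hypothesis hM : irreducible_operator M.
Hypothesis hq : is_Iprojection r (totemplex f M) q.
Variable B : 'M[R]_(dim_opker M, n).
Hypothesis hB : (B == opker M)%MS.
Hypothesis hZ : forall N, (0 < fluct_Z r f q B N)%E.

Local Notation k := (dim_opker M).
Local Notation coords := (k.-tuple (measurableTypeR R)).
Local Notation dom := (fluct_dom f q B).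

Let q_ge0 j : 0 <= q 0 j. Proof. by case: hq => -[[/(_ j)]]. Qed.

Lemma totemplex_sub_opker p : totemplex f M p -> (p - q <= opker M)%MS.
Proof.
by case: hq => -[_ qf] _ [_ pf]; apply/sub_kermxP; rewrite mulmxBl pf qf subrr.
Qed.

Lemma opker_sum0 (p : 'rV[R]_n) : (p <= opker M)%MS -> \sum_j p 0 j = 0.
Proof.
move=> /sub_kermxP pM; have [_ /submxP[u uM]] := hM.
have /matrixP/(_ 0 0) : p *m (const_mx 1 : 'rV[R]_n)^T = 0.
  by rewrite uM trmx_mul mulmxA pM mul0mx.
rewrite !mxE => {2}<-; apply: eq_bigr => j _.
by rewrite !mxE mulr1.
Qed.

Lemma basis_sub_opker (x : 'rV[R]_k) : (x *m B <= opker M)%MS.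
Proof. by rewrite (submx_trans (submxMl _ _))// (eqmxP hB). Qed.

Lemma basis_free (x : 'rV[R]_k) : x *m B = 0 -> x = 0.
Proof.
have Bfree : row_free B by rewrite /row_free (eqmxP hB).
by move=> xB; apply: (row_free_inj Bfree); rewrite xB mul0mx.
Qed.

(** Normalization and the moment constraints are automatic along ker M, so that
    in coordinates the TOTEMplex is a polyhedron cut out by sign conditions. *)
Lemma totemplex_basisE (x : 'rV[R]_k) :
  totemplex f M (q + x *m B) <-> forall j, 0 <= q 0 j + (x *m B) 0 j.
Proof.
have [[[_ q1] qf] _] := hq; have xker := basis_sub_opker x.
split=> [[[+ _] _] j|h]; first by move/(_ j); rewrite mxE.
split; last by rewrite mulmxDl (sub_kermxP xker) addr0.
split=> [j|]; first by rewrite mxE.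
under eq_bigr do rewrite mxE.
by rewrite big_split/= q1 opker_sum0// addr0.
Qed.

Lemma measurable_fluct_dom : measurable dom.
Proof.
have -> : dom = \bigcap_(j in [set: 'I_n])
    [set x | 0 <= q 0 j + (row_of_tuple x *m B) 0 j].
  apply/seteqP; split=> x; first by move/totemplex_basisE => h j _; exact: h.
  by move=> h; apply/totemplex_basisE => j; exact: h.
apply: fin_bigcap_measurable => // j _.
rewrite -[X in measurable X]setTI.
have mf : measurable_fun setT
    (fun x : coords => q 0 j + (row_of_tuple x *m B) 0 j).
  by apply: measurable_funD => //; exact: measurable_mulmx_coord.
have -> : [set x : coords | 0 <= q 0 j + (row_of_tuple x *m B) 0 j] =
    (fun x : coords => q 0 j + (row_of_tuple x *m B) 0 j) @^-1` `[0, +oo[.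
  by apply/seteqP; split=> x /=; rewrite in_itv/= andbT.
exact: mf.
Qed.

Lemma mulmx_col_coord (x : 'rV[R]_k) j : (x *m col j B) 0 0 = (x *m B) 0 j.
Proof. by rewrite colE mulmxA -colE mxE. Qed.

(** If column [j] of [B] were nonzero, [fluct_dom] would lie in the hyperplane
    orthogonal to it, as any of its points off the hyperplane would contradict
    [Iprojection_support]. *)
Lemma Iprojection_null_coord j (x : 'rV[R]_k) : q 0 j = 0 -> (x *m B) 0 j = 0.
Proof.
move=> qj; suff Bj : col j B = 0 by rewrite -mulmx_col_coord Bj mulmx0 mxE.
apply/eqP/negPn/negP => Bj {x}.
have domH : dom `<=` hyperplane (col j B).
  move=> x dx; rewrite /hyperplane/= mulmx_col_coord; apply/eqP/negPn/negP => xj.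
  have := (totemplex_basisE _).1 dx j; rewrite qj add0r le_eqVlt eq_sym (negbTE xj)/=.
  move=> xj0; have : 0 < q 0 j; last by rewrite qj ltxx.
  apply: (Iprojection_support (p := q + row_of_tuple x *m B) r_gt0 _ hq) => //.
  - by move=> p [].
  - move=> t /andP[t0 t1]; rewrite addrAC subrr add0r scalemxAl.
    apply/totemplex_basisE => i; rewrite -scalemxAl mxE.
    have -> : q 0 i + t * (row_of_tuple x *m B) 0 i =
        (1 - t) * q 0 i + t * (q 0 i + (row_of_tuple x *m B) 0 i) by ring.
    rewrite addr_ge0// mulr_ge0 ?subr_ge0 ?(ltW t0) ?(ltW t1)//.
    exact: (totemplex_basisE _).1 dx i.
  - by rewrite mxE qj add0r.
have dom0 : lebesgue_tuple k dom = 0%E.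
  apply: (subset_measure0 _ _ domH).
  - exact: measurable_fluct_dom.
  - exact: measurable_hyperplane.
  - exact: lebesgue_tuple_hyperplane.
(* For [N = 0] the weight is 1 and [fluct_Z] is the volume of [fluct_dom]. *)
have := hZ 0; rewrite /fluct_Z.
rewrite (eq_integral (cst 1%E)); last first.
  by move=> x _; rewrite /fluct_weight mul0r oppr0 expR0.
rewrite integral_cst ?mul1e; last exact: measurable_fluct_dom.
by move=> /lt_eqF/negbT/eqP; apply; exact: esym dom0.
Qed.

Lemma Iprojection_first_order (x : 'rV[R]_k) :
  \sum_j (x *m B) 0 j * ln (q 0 j / r 0 j) = 0.
Proof.
apply: (Iprojection_stationary r_gt0 _ hq).
- by move=> p [].
- by move=> j; exact: Iprojection_null_coord.
- exact/opker_sum0/basis_sub_opker.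
- move=> s sq; rewrite scalemxAl; apply/totemplex_basisE => j.
  rewrite -scalemxAl mxE; have := sq j; rewrite ler_norml => /andP[+ _].
  by have := q_ge0 j; lra.
Qed.

(** The I-divergence in excess of its minimum, as [Idiv_excess] shows; its terms
    with [q 0 j = 0] vanish. *)
Definition excess (x : coords) : R :=
  \sum_j q 0 j * bennett ((row_of_tuple x *m B) 0 j / q 0 j).

Lemma Idiv_excess (x : coords) : dom x ->
  Idiv (q + fluct B x) r = Idiv q r + excess x.
Proof.
move=> /totemplex_basisE dx; rewrite Idiv_expand//.
- by rewrite Iprojection_first_order addr0.
- by move=> j; exact: Iprojection_null_coord.
- exact/opker_sum0/basis_sub_opker.
Qed.

(** The Hessian of the I-divergence at [q], in coordinates. The convention
    [0^-1 = 0] is harmless: by [Iprojection_null_coord], column [j] of [B] is zero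
    when [q 0 j = 0]. *)
Definition precision : 'M[R]_k := B *m diag_mx (\row_j (q 0 j)^-1) *m B^T.

Lemma quad_precision (x : 'rV[R]_k) :
  quad precision x = \sum_j (x *m B) 0 j ^+ 2 / q 0 j.
Proof.
rewrite /quad /precision !mulmxA -mulmxA -trmx_mul mxE.
apply: eq_bigr => j _; rewrite mul_mx_diag !mxE -/((x *m B) 0 j).
by rewrite mulrAC expr2.
Qed.

Lemma posdefmx_precision : posdefmx precision.
Proof.
split=> [|v v0].
  by rewrite /precision !trmx_mul trmxK tr_diag_mx mulmxA.
rewrite -/(quad precision v) quad_precision.
have t_ge0 j : 0 <= (v *m B) 0 j ^+ 2 / q 0 j by rewrite divr_ge0 ?sqr_ge0.
rewrite lt0r sumr_ge0// andbT; apply: contra_neq v0 => /psumr_eq0P h.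
apply: basis_free; apply/rowP => j; rewrite [RHS]mxE.
have [qj|qj] := eqVneq (q 0 j) 0; first exact: Iprojection_null_coord.
have /eqP := h (fun j _ => t_ge0 j) j isT.
by rewrite mulf_eq0 invr_eq0 (negbTE qj) orbF sqrf_eq0 => /eqP.
Qed.

Lemma measurable_excess : measurable_fun setT excess.
Proof.
apply: measurable_sum => j; apply: measurable_funM => //.
have mt : measurable_fun setT
    (fun x : coords => (row_of_tuple x *m B) 0 j / q 0 j).
  by apply: measurable_funM => //; exact: measurable_mulmx_coord.
have mt1 : measurable_fun setT
    (fun x : coords => 1 + (row_of_tuple x *m B) 0 j / q 0 j).
  exact: measurable_funD.
apply: measurable_funB => //; apply: measurable_funM => //.
by apply: measurableT_comp mt1; exact: measurable_ln.
Qed.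

Local Notation Q x := (quad precision (row_of_tuple x) / 2).

Let quad_half (x : coords) : Q x =
  \sum_j q 0 j * (((row_of_tuple x *m B) 0 j / q 0 j) ^+ 2 / 2).
Proof.
rewrite quad_precision mulr_suml; apply: eq_bigr => j _.
have [->|qj] := eqVneq (q 0 j) 0; first by rewrite invr0 mulr0 !mul0r.
by field.
Qed.

(** Bounds the ratios [pi_j / q_j] on the TOTEMplex, where [q_j + pi_j <= 1], and
    [pi_j ^ 2 / q_j ^ 2] by a multiple of [pi_j ^ 2 / q_j]; the vanishing [q_j]
    contribute 0 to the sum. *)
Definition ratio_bound : R := \sum_j (q 0 j)^-1.

Let invq_le j : (q 0 j)^-1 <= ratio_bound.
Proof.
rewrite /ratio_bound (bigD1 j)//= lerDl; apply: sumr_ge0 => i _.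
by rewrite invr_ge0.
Qed.

Let ratio_bound_ge0 : 0 <= ratio_bound.
Proof. by apply: sumr_ge0 => i _; rewrite invr_ge0. Qed.

Lemma excess_ge (x : coords) : dom x -> (1 + ratio_bound)^-1 * Q x <= excess x.
Proof.
move=> dx; have [[p_ge0 p1] _] := dx.
rewrite quad_half mulr_sumr; apply: ler_sum => j _.
rewrite mulrCA; apply: ler_wpM2l => //.
have := q_ge0 j; rewrite le_eqVlt => /predU1P[<-|qj].
  by rewrite invr0 mulr0 expr0n/= mul0r mulr0 bennett_ge0// lerN10.
rewrite mulrC; apply: bennett_ge => //; apply/andP; split.
  rewrite ler_pdivlMr// mulN1r -subr_ge0 opprK addrC.
  exact: (totemplex_basisE _).1 dx j.
apply: le_trans (invq_le j); rewrite -[leRHS]mul1r ler_pM2r ?invr_gt0//.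
have pj : (q + fluct B x) 0 j <= 1.
  by rewrite -p1 (bigD1 j)//= lerDl sumr_ge0.
by move: pj; rewrite mxE => /(le_trans _); apply; rewrite lerDr.
Qed.

(** A small value of the quadratic form makes all the ratios [pi_j / q_j] smaller
    than [d] in absolute value; this gives both membership in the TOTEMplex and the
    second-order bounds on [bennett]. *)
Lemma excess_local (d : R) : 0 < d < 1 -> exists2 e, 0 < e &
  forall x : coords, Q x < e ->
    dom x /\ Q x / (1 + d) <= excess x <= Q x / (1 - d).
Proof.
move=> /andP[d0 d1]; exists (d ^+ 2 / (2 * ratio_bound + 1)).
  by rewrite divr_gt0 ?exprn_gt0// ltr_wpDl// mulr_ge0.
move=> x Qx.
have td j : `|(row_of_tuple x *m B) 0 j / q 0 j| <= d.
  rewrite -(ler_pXn2r (n := 2))// ?nnegrE ?normr_ge0 ?(ltW d0)// real_normK ?num_real//.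
  have Q_ge : q 0 j * (((row_of_tuple x *m B) 0 j / q 0 j) ^+ 2 / 2) <= Q x.
    rewrite quad_half (bigD1 j)//= lerDl; apply: sumr_ge0 => i _.
    by rewrite mulr_ge0// divr_ge0// sqr_ge0.
  have := q_ge0 j; rewrite le_eqVlt => /predU1P[<-|qj].
    by rewrite invr0 mulr0 expr0n/= sqr_ge0.
  move: Qx; rewrite ltr_pdivlMr ?ltr_wpDl ?mulr_ge0// => Qx.
  set t := ((row_of_tuple x *m B) 0 j / q 0 j) in Q_ge *.
  have : t ^+ 2 <= 2 * Q x * (q 0 j)^-1.
    by rewrite ler_pdivlMr//; move: Q_ge; lra.
  move=> /le_trans; apply.
  have Q0 : 0 <= Q x.
    by rewrite divr_ge0// quad_ge0//; exact: posdefmx_precision.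
  apply: (@le_trans _ _ (2 * Q x * ratio_bound)).
    by apply: ler_wpM2l => //; rewrite mulr_ge0.
  by move: Qx Q0; move: (Q x) => y; lra.
have h j : - d <= (row_of_tuple x *m B) 0 j / q 0 j <= d by rewrite -ler_norml.
split.
  apply/totemplex_basisE => j.
  have := q_ge0 j; rewrite le_eqVlt => /predU1P[qj|qj].
    by rewrite Iprojection_null_coord// addr0.
  have /andP[+ _] := h j; rewrite ler_pdivlMr// => hj.
  have : 0 <= (1 - d) * q 0 j by rewrite mulr_ge0// ?subr_ge0 ltW.
  by lra.
rewrite quad_half !mulr_suml; apply/andP; split; apply: ler_sum => j _.
  rewrite -mulrA ler_wpM2l// bennett_ge ?(ltW d0)//.
  by case/andP: (h j) => h1 h2; apply/andP; split=> //; lra.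
by rewrite -mulrA ler_wpM2l// bennett_le ?(ltW d0)//; case/andP: (h j).
Qed.

Let w N : coords -> R := (fun x => expR (- (N%:R * excess x))) \_ dom.

(** The constant factor [expR (- N * Idiv q r)] of the weight cancels in
    [fluct_prob], where [Idiv] may thus be replaced by [excess]. *)
Lemma fluct_weightE N (A : set coords) : measurable A ->
  (\int[lebesgue_tuple k]_(x in A `&` dom) (fluct_weight r q B N x)%:E =
   (expR (- (N%:R * Idiv q r)))%:E * \int[lebesgue_tuple k]_(x in A) (w N x)%:E)%E.
Proof.
move=> mA; have mw : measurable_fun setT (w N).
  apply/(measurable_restrictT _ measurable_fluct_dom); apply: measurable_funTS.
  apply: measurableT_comp => //; apply: measurableT_comp => //.
  by apply: measurable_funM => //; exact: measurable_excess.
have w0 x : 0 <= w N x by rewrite /w /patch; case: ifP => // _; exact: expR_ge0.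
rewrite -ge0_integralZl_EFin ?expR_ge0//; last 2 first.
- by move=> x _; rewrite lee_fin.
- by apply/measurable_EFinP; apply: measurable_funTS.
rewrite integral_mkcondr; apply: eq_integral => x _.
rewrite /w /patch; case: ifPn; last by rewrite mule0.
rewrite inE => dx; rewrite -EFinM -expRD /fluct_weight Idiv_excess//.
by rewrite mulrDr opprD.
Qed.

Lemma fluct_probE N A : measurable A ->
  fluct_prob r f q B N A =
  ((fine (\int[lebesgue_tuple k]_x (w N x)%:E))^-1%:E *
   \int[lebesgue_tuple k]_(x in A) (w N x)%:E)%E.
Proof.
move=> mA; have := fluct_weightE N measurableT; rewrite setTI => ZE.
rewrite /fluct_prob /fluct_Z ZE fluct_weightE//.
set K := expR _; set I := (\int[_]_x _)%E; set J := (\int[_]_(x in A) _)%E.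
have K0 : 0 < K by exact: expR_gt0.
have -> : fine (K%:E * I)%E = K * fine I.
  by case: I => [s||] //=; rewrite ?mulr0 mulr_infty gtr0_sg// mul1e.
by rewrite muleA -EFinM invfM mulrC mulrA divff ?mul1r// gt_eqF.
Qed.

Lemma fluct_weight_pos N : (0 < \int[lebesgue_tuple k]_x (w N x)%:E)%E.
Proof.
have := hZ N; rewrite /fluct_Z -[dom in X in (_ < X)%E]setTI fluct_weightE//.
by rewrite pmule_rgt0// lte_fin expR_gt0.
Qed.

Lemma fluct_tv_cvg :
  tv_dist (fluct_prob r f q B N) (mvnormal_prob 0 (N%:R^-1 *: invmx precision))
    @[N --> \oo] --> 0%E.
Proof.
apply: (@laplace_tv _ _ _ dom excess (1 + ratio_bound)^-1).
- exact: posdefmx_precision.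
- exact: measurable_fluct_dom.
- exact: measurable_excess.
- by rewrite invr_gt0 ltr_pwDl// invf_le1 ?ltr_pwDl// lerDl.
- exact: excess_ge.
- exact: excess_local.
- exact: fluct_weight_pos.
- exact: fluct_probE.
Qed.
End fluctuations.

Theorem theorem3p7 (R : realType) (T : finType) (Ds : {set T})
  (f : T -> R) (hf : is_distribution f)
  (hf0 : forall e, e \notin Ds -> f e = 0)
  (u : T -> R) (hu : is_distribution u)
  (hu0 : forall e, e \in Ds -> 0 < u e)
  (D : nat) (M : 'M[R]_(D, #|Ds|)) (hM : irreducible_operator M)
  (q : 'rV[R]_#|Ds|)
  (hq : is_Iprojection (restr Ds u) (totemplex (restr Ds f) M) q)
  (B : 'M[R]_(dim_opker M, #|Ds|)) (hB : (B == opker M)%MS)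
  (hZ : forall N, (0 < fluct_Z (restr Ds u) (restr Ds f) q B N)%E) :
  (forall p, totemplex (restr Ds f) M p -> (p - q <= opker M)%MS) /\
  exists S : nat -> 'M[R]_(dim_opker M),
    [/\ forall N, (0 < N)%N -> posdefmx (S N),
        forall i j, (fun N => (B^T *m S N *m B) i j : R^o)
                      =O_\oo (fun N => N%:R^-1 : R^o)
      & tv_dist (fluct_prob (restr Ds u) (restr Ds f) q B N)
                (mvnormal_prob 0 (S N)) @[N --> \oo] --> 0%E].
Proof.
have r_gt0 j : 0 < restr Ds u 0 j by rewrite mxE hu0// enum_valP.
split=> [p|]; first exact: (totemplex_sub_opker hq).
exists (fun N => N%:R^-1 *: invmx (precision q B)); split.
- move=> N N0; apply: posdefmxZ; first by rewrite invr_gt0 ltr0n.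
  exact: posdefmx_inv (posdefmx_precision r_gt0 hM hq hB hZ).
- move=> i j; apply/eqOP; near=> c; near=> N.
  rewrite -scalemxAr -scalemxAl mxE normrM mulrC ler_wpM2r//.
- exact: (fluct_tv_cvg r_gt0 hM hq hB hZ).
Unshelve. all: by end_near. Qed.
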